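(* For every $d\ge 1$, $$\mathrm{edim}(Q_d)\le \dim(Q_d)\le \mathrm{edim}(Q_d)+1,$$ and if $\dim(Q_d)=\mathrm{edim}(Q_d)+1$ then $d$ is even.
   Context: The hypercube $Q_d$ has vertex set $\{0,1\}^d$, two vertices adjacent iff they differ in exactly one coordinate; distance is the number of differing coordinates. For a vertex $x$ and an edge $uv$, $d(uv,x)=\min\{d(u,x),d(v,x)\}$. A set $S$ of vertices is a metric generator if for every two distinct vertices $u,v$ some $s\in S$ has $d(u,s)\ne d(v,s)$; it is an edge metric generator if for every two distinct edges $e_1,e_2$ some $s\in S$ has $d(e_1,s)\ne d(e_2,s)$. $\dim(G)$ (metric dimension) and $\mathrm{edim}(G)$ (edge metric dimension) are the minimum cardinalities of a metric generator and of an edge metric generator of $G$, respectively.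
   Formalization: Metric generators and edge metric generators are required to be nonempty; otherwise the empty set gives edim(Q_1) = 0 while dim(Q_1) = 1, and the parity claim fails at d = 1. No other value is changed. *)

(* Defs.v *)
(* MathComp *)
From mathcomp Require Import all_boot.

Set Implicit Arguments.
Unset Strict Implicit.
Unset Printing Implicit Defensive.

Definition cube (d : nat) : finType := {ffun 'I_d -> bool}.

Definition cube_dist (d : nat) (x y : cube d) : nat := #|[set i | x i != y i]|.

Definition cube_adj (d : nat) : rel (cube d) := fun x y => cube_dist x y == 1.

(* The edge joining u and v is given by its two ends; [edge_dist] is symmetric
   in u and v, and two edges are compared as unordered pairs below. *)
Definition edge_dist (d : nat) (u v x : cube d) : nat :=
  minn (cube_dist u x) (cube_dist v x).

Definition metric_generator (d : nat) (S : {set cube d}) : bool :=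
  [forall u, forall v, (u != v) ==>
    [exists s in S, cube_dist u s != cube_dist v s]].

Definition edge_metric_generator (d : nat) (S : {set cube d}) : bool :=
  [forall u1, forall v1, forall u2, forall v2,
    [&& cube_adj u1 v1, cube_adj u2 v2 & [set u1; v1] != [set u2; v2]] ==>
    [exists s in S, edge_dist u1 v1 s != edge_dist u2 v2 s]].

(* Generators are taken to be nonempty.  This matters only for [edim 1]: the
   graph Q_1 has a single edge, so the empty set separates its edges vacuously,
   while the usual convention gives the one-edge path edge metric dimension 1.
   The full vertex set, used as the starting point of [arg min], is a nonempty
   generator of either kind: see [dimP] and [edimP]. *)
Definition dim (d : nat) : nat :=
  #|[arg min_(S < [set: cube d] | (S != set0) && metric_generator S) #|S| ]|.

Definition edim (d : nat) : nat :=
  #|[arg min_(S < [set: cube d] | (S != set0) && edge_metric_generator S) #|S| ]|.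

Lemma cube_dist_eq0 (d : nat) (x y : cube d) : (cube_dist x y == 0) = (x == y).
Proof.
rewrite cards_eq0; apply/eqP/eqP => [E|->]; last first.
  by apply/setP => i; rewrite !inE eqxx.
apply/ffunP => i; apply/eqP; apply: contraT => ni.
by move/setP/(_ i): E; rewrite !inE ni.
Qed.

Lemma edge_dist_eq0 (d : nat) (u v x : cube d) :
  (edge_dist u v x == 0) = (x \in [set u; v]).
Proof.
rewrite /edge_dist -leqn0 geq_min !leqn0 !cube_dist_eq0 !inE.
by rewrite ![x == _]eq_sym.
Qed.

Lemma cube_setT_neq0 (d : nat) : [set: cube d] != set0.
Proof. by apply/set0Pn; exists [ffun=> false]; rewrite inE. Qed.

Lemma metric_generator_setT (d : nat) : metric_generator [set: cube d].
Proof.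
apply/forallP => u; apply/forallP => v; apply/implyP => uv.
apply/existsP; exists u; rewrite inE /=.
have /eqP -> : cube_dist u u == 0 by rewrite cube_dist_eq0.
by rewrite eq_sym cube_dist_eq0 eq_sym.
Qed.

Lemma edge_metric_generator_setT (d : nat) : edge_metric_generator [set: cube d].
Proof.
do 4 (apply/forallP => ?); apply/implyP => /and3P[_ _].
move=> ne; apply: contraNT ne => /existsPn H.
apply/eqP/setP => x; move: (H x); rewrite inE /= negbK => /eqP E.
by rewrite -!edge_dist_eq0 E.
Qed.

Lemma dimP (d : nat) :
  (exists2 S : {set cube d}, (S != set0) && metric_generator S & #|S| = dim d) /\
  (forall S : {set cube d}, S != set0 -> metric_generator S -> dim d <= #|S|).
Proof.
rewrite /dim; case: arg_minnP => [|S PS minS].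
  by rewrite cube_setT_neq0 metric_generator_setT.
by split=> [|S' S'0 gS']; [exists S | apply: minS; rewrite S'0].
Qed.

Lemma edimP (d : nat) :
  (exists2 S : {set cube d}, (S != set0) && edge_metric_generator S
     & #|S| = edim d) /\
  (forall S : {set cube d}, S != set0 -> edge_metric_generator S ->
     edim d <= #|S|).
Proof.
rewrite /edim; case: arg_minnP => [|S PS minS].
  by rewrite cube_setT_neq0 edge_metric_generator_setT.
by split=> [|S' S'0 gS']; [exists S | apply: minS; rewrite S'0].
Qed.

(* Main.v *)
Require Import Defs.
From mathcomp Require Import all_boot.
From mathcomp Require Import zify.

(* Write [P u] for the parity of the number of ones of [u].  For an edge [e] in
   direction [i] at [u], the distance [d(e, s)] is [d(u, s) - (u i != s i)],
   which is congruent to [P u + P s + u i + s i] modulo 2.  If a metric generator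
   S fails to separate two edges of directions [i != j], comparing parities shows
   that [s i + s j] is constant modulo 2 on S; then S does not separate suitable
   vertices differing exactly in [i] and [j].  Edges of equal direction reduce to
   vertices, so every metric generator is an edge metric generator.

   Conversely, let S be a nonempty edge metric generator.  Two distinct vertices
   that S does not separate are antipodal (a common coordinate would give two
   unseparated parallel edges), hence both lie at distance d/2 from every
   element of S.  So d is even, and there is at most one such pair; adding one
   of its elements to S separates it, the distances being 0 and d. *)

Section Cube.

Set Implicit Arguments.
Unset Strict Implicit.

Context {d : nat}.
Implicit Types (u v w x y s : cube d) (i j k : 'I_d) (S : {set cube d}).

Definition flip i u : cube d := [ffun k => (k == i) (+) u k].

Lemma flipK i : involutive (flip i).
Proof. by move=> u; apply/ffunP => k; rewrite !ffunE addKb. Qed.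

Lemma cube_distE u v : cube_dist u v = \sum_i (u i != v i).
Proof.
rewrite /cube_dist -sum1_card big_mkcond /=.
by apply: eq_bigr => i _; rewrite inE; case: (_ == _).
Qed.

(** Only coordinate [i] contributes differently; the additive form avoids truncated subtraction. *)
Lemma cube_dist_flip i u s :
  cube_dist (flip i u) s + (u i != s i) = cube_dist u s + (u i == s i).
Proof.
rewrite !cube_distE (bigD1 i) //= [in RHS](bigD1 i) //= ffunE eqxx.
rewrite (eq_bigr (fun k => (u k != s k) : nat)).
  by case: (u i); case: (s i) => /=; lia.
by move=> k /negPf ki; rewrite ffunE ki.
Qed.

Lemma cube_dist_xx u : cube_dist u u = 0.
Proof. by apply/eqP; rewrite cube_dist_eq0. Qed.

Lemma cube_adj_flip i u : cube_adj u (flip i u).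
Proof.
have := cube_dist_flip i u (flip i u).
rewrite /cube_adj cube_dist_xx ffunE eqxx.
by case: (u i) => /=; lia.
Qed.

Lemma cube_adjP u v : cube_adj u v -> exists i, v = flip i u.
Proof.
case/cards1P => i /setP E; exists i; apply/ffunP => k.
have := E k; rewrite !inE ffunE => <-.
by case: (u k); case: (v k).
Qed.

Lemma edge_dist_flip i u s :
  edge_dist u (flip i u) s + (u i != s i) = cube_dist u s.
Proof.
have := cube_dist_flip i u s; rewrite /edge_dist.
by case: (_ == _) => /=; lia.
Qed.

Definition parity u := \big[addb/false]_i u i.

Lemma odd_cube_dist u v : odd (cube_dist u v) = parity u (+) parity v.
Proof.
rewrite cube_distE (big_morph odd oddD (erefl : odd 0 = false)) -big_split /=.
by apply: eq_bigr => i _; case: (u i); case: (v i).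
Qed.

Lemma metric_generatorP S :
  reflect
    (forall u v, (forall s, s \in S -> cube_dist u s = cube_dist v s) -> u = v)
    (metric_generator S).
Proof.
apply: (iffP idP) => [/forallP gS u v E|H].
  apply/eqP; apply: contraT => uv; move/forallP/(_ v): (gS u); rewrite uv /=.
  by case/existsP => s /andP[sS]; rewrite E ?eqxx.
apply/forallP => u; apply/forallP => v; apply/implyP; apply: contraR.
move=> /existsPn E; apply/eqP/H => s sS.
by move: (E s); rewrite sS /= negbK => /eqP.
Qed.

Lemma edge_metric_generatorP S :
  reflect
    (forall i j u v,
       (forall s, s \in S ->
          edge_dist u (flip i u) s = edge_dist v (flip j v) s) ->
       [set u; flip i u] = [set v; flip j v])
    (edge_metric_generator S).
Proof.
apply: (iffP idP) => [gS i j u v E|H].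
  apply/eqP; apply: contraT => uv.
  move: gS => /forallP/(_ u)/forallP/(_ (flip i u))/forallP/(_ v).
  move/forallP/(_ (flip j v)); rewrite !cube_adj_flip uv /=.
  by case/existsP => s /andP[sS]; rewrite E ?eqxx.
apply/forallP => u; apply/forallP => u'; apply/forallP => v; apply/forallP => v'.
apply/implyP => /and3P[/cube_adjP[i ->] /cube_adjP[j ->]]; apply: contraR.
move=> /existsPn E; apply/eqP/H => s sS.
by move: (E s); rewrite sS /= negbK => /eqP.
Qed.

Lemma edge_flipC i u : [set flip i u; flip i (flip i u)] = [set u; flip i u].
Proof. by rewrite flipK setUC. Qed.

Lemma edge_dist_flipC i u s :
  edge_dist (flip i u) (flip i (flip i u)) s = edge_dist u (flip i u) s.
Proof. by rewrite flipK /edge_dist minnC. Qed.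

Lemma metric_generator_edge S : metric_generator S -> edge_metric_generator S.
Proof.
move/metric_generatorP => gS; apply/edge_metric_generatorP => i j u v E.
have [eij|nij] := eqVneq i j.
  rewrite -{j}eij in E *.
  (* Replacing [v] by [flip i v] names the same edge, so the chosen ends may be assumed to agree at
     [i]; equal edge distances then give equal vertex distances. *)
  wlog uvi : v E / u i = v i => [W|].
    have [/W->//|uvi] := eqVneq (u i) (v i).
    rewrite -(edge_flipC i v); apply: W => [s /E->|].
      by rewrite edge_dist_flipC.
    by rewrite ffunE eqxx; move: uvi; case: (u i); case: (v i).
  by rewrite (gS u v) // => s sS; rewrite -!(edge_dist_flip i) E ?uvi.
pose c := parity u (+) parity v (+) u i (+) v j.
have Ec s : s \in S -> s i (+) s j = c.
  move=> /E Es; have := odd_cube_dist u s; have := odd_cube_dist v s.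
  rewrite -(edge_dist_flip i u) -(edge_dist_flip j v) Es !oddD /c.
  by case: odd; case: (u i); case: (v j); case: (s i); case: (s j);
     case: (parity u); case: (parity v); case: (parity s).
(* Since [x i (+) x j = ~~ c], each [s] in [S] agrees with [x] at exactly one of [i] and [j], so
   flipping both preserves the distance to [s]. *)
pose x : cube d := [ffun k => (k == i) && ~~ c].
have xi : x i = ~~ c by rewrite ffunE eqxx.
have xj : x j = false by rewrite ffunE eq_sym (negPf nij).
have /ffunP/(_ i) : flip i (flip j x) = x.
  apply: gS => s /Ec sc.
  have := cube_dist_flip i (flip j x) s; have := cube_dist_flip j x s.
  rewrite [flip j x i]ffunE (negPf nij) xi xj -sc.
  by case: (s i); case: (s j) => /=; lia.
by rewrite !ffunE eqxx (negPf nij) /=; case: (c).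
Qed.

Lemma unseparated_antipodal S u v : edge_metric_generator S -> u != v ->
  (forall s, s \in S -> cube_dist u s = cube_dist v s) ->
  forall i, v i = ~~ u i.
Proof.
move/edge_metric_generatorP => gS uv E i.
have [uvi|] := eqVneq (u i) (v i); last by case: (u i); case: (v i).
(* Agreement at [i] makes the two edges in direction [i] equidistant from all of [S], hence
   equal. *)
have : u \in [set v; flip i v].
  rewrite -(gS i i u v) ?set21 // => s /E Es.
  by apply: (@addIn (u i != s i)); rewrite [in RHS]uvi !edge_dist_flip.
rewrite !inE (negPf uv) /= => /eqP uE.
by move: uvi; rewrite uE ffunE eqxx; case: (v i).
Qed.

Lemma antipodal_dist u v s : (forall i, v i = ~~ u i) ->
  cube_dist u s + cube_dist v s = d.
Proof.
move=> uv; rewrite !cube_distE -big_split /=.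
rewrite (eq_bigr (fun=> 1)) ?sum1_card ?card_ord // => i _.
by rewrite uv; case: (u i); case: (s i).
Qed.

Lemma edge_metric_generator_odd S : odd d -> S != set0 ->
  edge_metric_generator S -> metric_generator S.
Proof.
move=> dodd /set0Pn[s sS] gS; apply/metric_generatorP => u v E.
apply/eqP; apply: contraLR dodd => uv.
have a := unseparated_antipodal gS uv E.
by rewrite -(antipodal_dist s a) E // addnn odd_double.
Qed.

Lemma edge_metric_generator_add S : 0 < d -> edge_metric_generator S ->
  exists u, metric_generator (u |: S).
Proof.
move=> dgt0 gS; have [mS|] := boolP (metric_generator S).
  exists [ffun=> false]; apply/metric_generatorP => u v E.
  by move/metric_generatorP: mS; apply=> s sS; apply/E/setU1r.
move=> /forallPn[u /forallPn[v]]; rewrite negb_imply => /andP[uv /existsPn E].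
have {}E s : s \in S -> cube_dist u s = cube_dist v s.
  by move=> sS; move: (E s); rewrite sS /= negbK => /eqP.
have a := unseparated_antipodal gS uv E.
exists u; apply/metric_generatorP => x y Exy; apply/eqP; apply: contraT => xy.
have ExyS s : s \in S -> cube_dist x s = cube_dist y s.
  by move=> sS; apply/Exy/setU1r.
have b := unseparated_antipodal gS xy ExyS.
(* As [u] does not separate the antipodes [x] and [y], twice the distance from [x] to [u] is [d];
   this excludes [x = u]. *)
have Exu := antipodal_dist u b; rewrite -Exy ?setU11 // in Exu.
have [xu|xu] := eqVneq x u; first by move: Exu; rewrite xu cube_dist_xx; lia.
(* Both [u] and [x] lie at distance d/2 from every element of [S], so they are antipodal too, at
   distance [d] instead of d/2. *)
have c : forall i, u i = ~~ x i.
  apply: unseparated_antipodal gS xu _ => s sS.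
  have := antipodal_dist s a; have := antipodal_dist s b.
  by rewrite -E // -ExyS //; lia.
by have := antipodal_dist u c; rewrite cube_dist_xx; lia.
Qed.

End Cube.

Theorem theorem4 (d : nat) (hd : 1 <= d) :
  (edim d <= dim d <= edim d + 1) /\
  (dim d = edim d + 1 -> ~~ odd d).
Proof.
have [[S /andP[S0 gS] <-] dim_min] := dimP d.
have [[T /andP[T0 gT] <-] edim_min] := edimP d.
have [u uT] := edge_metric_generator_add hd gT.
have uT0 : u |: T != set0 by apply/set0Pn; exists u; rewrite setU11.
split.
  rewrite (edim_min _ S0 (metric_generator_edge gS)) /=.
  apply: leq_trans (dim_min _ uT0 uT) _.
  by rewrite cardsU1 addnC leq_add2l leq_b1.
move=> E; apply/negP => dodd.
have := dim_min _ T0 (edge_metric_generator_odd dodd T0 gT).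
by rewrite E addn1 ltnn.
Qed.
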